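(* Let $n>n'\ge 0$ be integers, let $\rho\ge 0$ be a real number and let $p\in(0,1)$. Let $X\in\mathrm{Bin}(n,p)$ and $Y\in\mathrm{Bin}(n',p)$ be independent random variables. For every integer $M\ge -1$, let $$p_X(M,\rho)=\mathbb P(X>M,\,X>Y)+\tfrac12\,\mathbb P(X=Y>M)+\tfrac1{\rho+1}\,\mathbb P(X=M>Y)+\tfrac1{\rho+2}\,\mathbb P(X=Y=M),$$ and define $p_Y(M,\rho)$ similarly by exchanging $X$ and $Y$, that is, $$p_Y(M,\rho)=\mathbb P(Y>M,\,Y>X)+\tfrac12\,\mathbb P(X=Y>M)+\tfrac1{\rho+1}\,\mathbb P(Y=M>X)+\tfrac1{\rho+2}\,\mathbb P(X=Y=M).$$ Then, for every integer $M\in[0,n]$, $$\frac{p_X(M,\rho)}{p_Y(M,\rho)}\ \ge\ \frac{p_X(-1,\rho)}{p_Y(-1,\rho)}=\frac{\mathbb P(X>Y)+\frac12\mathbb P(X=Y)}{\mathbb P(Y>X)+\frac12\mathbb P(Y=X)}.$$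
   Context: $X\in\mathrm{Bin}(n,p)$ means that $X$ is binomially distributed with parameters $n$ and $p$. Convention: a fraction with positive numerator and denominator $0$ is equal to $+\infty$. *)

(* Defs.v *)
From HB Require Import structures.
From mathcomp Require Import all_boot all_order all_algebra.
From mathcomp Require Import all_classical all_reals all_analysis.

Set Implicit Arguments.
Unset Strict Implicit.
Unset Printing Implicit Defensive.

Import Order.TTheory GRing.Theory Num.Theory.

Local Open Scope classical_set_scope.
Local Open Scope ring_scope.
Local Open Scope ereal_scope.

Definition independent_RV2 {d d1 d2 : measure_display} {T : measurableType d}
    {T1 : measurableType d1} {T2 : measurableType d2} {R : realType}
    (P : probability T R) (X : T -> T1) (Y : T -> T2) : Prop :=
  forall (A : set T1) (B : set T2), measurable A -> measurable B ->
    P (X @^-1` A `&` Y @^-1` B) = P (X @^-1` A) * P (Y @^-1` B).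

(* [win_prob P X Y rho M] is p_X(M, rho); p_Y(M, rho) is [win_prob P Y X rho M].
   The threshold M is an integer because the value M = -1 is allowed. *)
Definition win_prob {d : measure_display} {T : measurableType d} {R : realType}
    (P : probability T R) (X Y : T -> nat) (rho : R) (M : int) : \bar R :=
  P [set t | (M < (X t)%:Z)%R /\ (Y t < X t)%N]
  + (2^-1)%:E * P [set t | X t = Y t /\ (M < (Y t)%:Z)%R]
  + ((rho + 1)^-1)%:E * P [set t | (X t)%:Z = M /\ ((Y t)%:Z < M)%R]
  + ((rho + 2)^-1)%:E * P [set t | X t = Y t /\ (Y t)%:Z = M].

(* The quotient of \bar R satisfies 0^-1 = +oo, hence a / 0 = +oo for 0 < a. *)
Definition win_ratio {d : measure_display} {T : measurableType d} {R : realType}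
    (P : probability T R) (X Y : T -> nat) (rho : R) (M : int) : \bar R :=
  win_prob P X Y rho M / win_prob P Y X rho M.

(* Main.v *)
(** Condition on the sum S = X + Y: given S, the law of (X, Y) does not depend
    on p and is given by the products C(n, k) C(n', S - k).  Let A_S and B_S be
    the weights of "X wins" and "Y wins" on X + Y = S without threshold (a tie
    counts one half), and let A_S(M), B_S(M) be the weights with threshold M.
    - For fixed S the odds C(n, k) C(n', l) / (C(n, l) C(n', k)) of k = max
      increase with k, and the threshold favours large k; hence
      A_S(M) / A_S >= B_S(M) / B_S.
    - A_S(M) / A_S is nondecreasing in S, by log-concavity of l |-> C(n', l).
    - A_S / B_S is nondecreasing in S: drawing one more element changes the
      leader only at a tie, and then in favour of the larger population.
    Chebyshev's sum inequality turns the monotonicity of both ratios into the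
    inequality for the sums over S. *)
Require Import Defs.
From HB Require Import structures.
From mathcomp Require Import all_boot all_order all_algebra.
From mathcomp Require Import all_classical all_reals all_analysis.
From mathcomp Require Import ring lra zify.

Set Implicit Arguments.
Unset Strict Implicit.
Unset Printing Implicit Defensive.

Import Order.TTheory GRing.Theory Num.Theory.

Local Open Scope classical_set_scope.
Local Open Scope ring_scope.

(** * Chebyshev's sum inequality and ratios of binomial coefficients *)

(** Symmetrising in k and l, twice the difference of the two sides is the double sum of (t k - t l)
    (u k v l - u l v k), whose factors never have opposite signs. Monotonicity of u / v is stated
    without division because v may vanish. *)
Lemma chebyshev_sum (R : realFieldType) (m : nat) (u v t : nat -> R) :
  (forall k l, (l <= k < m)%N -> u l * v k <= u k * v l) ->
  (forall k l, (l <= k < m)%N -> t l <= t k) ->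
  (\sum_(k < m) u k) * (\sum_(k < m) v k * t k)
    <= (\sum_(k < m) u k * t k) * (\sum_(k < m) v k).
Proof.
move=> huv ht.
pose F (k l : 'I_m) := u k * t k * v l - u k * (v l * t l).
have sF : (\sum_(k < m) u k * t k) * (\sum_(k < m) v k) -
    (\sum_(k < m) u k) * (\sum_(k < m) v k * t k) = \sum_k \sum_l F k l.
  rewrite !big_distrl /= -sumrB; apply: eq_bigr => k _.
  by rewrite !big_distrr /= -sumrB.
rewrite -subr_ge0 sF -(@pmulrn_lge0 _ _ 2) // mulr2n.
rewrite [X in _ + X]exchange_big -big_split; apply: sumr_ge0 => k _.
rewrite -big_split; apply: sumr_ge0 => l _ /=.
suff -> : F k l + F l k = (t k - t l) * (u k * v l - u l * v k).
  have [lk|/ltnW kl] := leqP l k.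
    by apply: mulr_ge0; rewrite subr_ge0 ?ht ?huv // lk /=.
  by apply: mulr_le0; rewrite subr_le0 ?ht ?huv // kl /=.
by rewrite /F; ring.
Qed.

Lemma bin_log_concave (m i j : nat) : (i <= j)%N ->
  ('C(m, j.+1) * 'C(m, i) <= 'C(m, i.+1) * 'C(m, j))%N.
Proof.
move=> ij; have [jm|mj] := ltnP j m; last by rewrite bin_small ?mul0n.
have Hi := mul_bin_left m i; have Hj := mul_bin_left m j.
rewrite -(@leq_pmul2l (i.+1 * j.+1)) ?muln_gt0 //.
have -> : (i.+1 * j.+1 * ('C(m, j.+1) * 'C(m, i)) =
  (j.+1 * 'C(m, j.+1)) * (i.+1 * 'C(m, i)))%N by ring.
have -> : (i.+1 * j.+1 * ('C(m, i.+1) * 'C(m, j)) =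
  (i.+1 * 'C(m, i.+1)) * (j.+1 * 'C(m, j)))%N by ring.
rewrite Hi Hj.
have -> : ((m - j) * 'C(m, j) * (i.+1 * 'C(m, i)) =
  ((m - j) * i.+1) * ('C(m, j) * 'C(m, i)))%N by ring.
have -> : ((m - i) * 'C(m, i) * (j.+1 * 'C(m, j)) =
  ((m - i) * j.+1) * ('C(m, j) * 'C(m, i)))%N by ring.
by rewrite leq_mul2r; apply/orP; right; apply: leq_mul; lia.
Qed.

(** Passing from k to k + 1 multiplies 'C(n, k) by (n - k) / (k + 1) and 'C(m, k) by the smaller (m
    - k) / (k + 1). *)
Lemma bin_ratio_mono (m n k l : nat) : (m <= n)%N -> (l <= k)%N ->
  ('C(n, l) * 'C(m, k) <= 'C(n, k) * 'C(m, l))%N.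
Proof.
move=> mn; elim: k => [|k IH]; first by rewrite leqn0 => /eqP->.
rewrite leq_eqVlt => /predU1P[->//|]; rewrite ltnS => /IH {}IH.
have Hm := mul_bin_left m k; have Hn := mul_bin_left n k.
rewrite -(@leq_pmul2l k.+1) // mulnCA Hm [leqRHS]mulnA Hn.
have -> : ('C(n, l) * ((m - k) * 'C(m, k)) = (m - k) * ('C(n, l) * 'C(m, k)))%N.
  by ring.
by rewrite -mulnA; apply: leq_mul => //; lia.
Qed.

(** * Weights conditional on the sum S *)

Definition win {R : realFieldType} (k l : nat) : R :=
  if (l < k)%N then 1 else if k == l then 2^-1 else 0.

(** The guard makes the weight vanish for k > S, where S - k would truncate to 0; sums for S may
    then be extended to larger k. *)
Definition win_weight {R : realFieldType} (n m S k : nat) : R :=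
  if (k <= S)%N then 'C(n, k)%:R * 'C(m, S - k)%:R * win k (S - k) else 0.

(* The fraction of [win k (S - k)] that survives the threshold M when
   s = 1 / (rho + 1); a tie at M keeps 1 / (rho + 2) = 2^-1 * (2 s / (1 + s)).
   The value 1 at k = M, S > M.*2 is irrelevant there, since [win] vanishes, but
   makes the fraction nondecreasing in S. *)
Definition threshold {R : realFieldType} (s : R) (M S k : nat) : R :=
  if (M < k)%N then 1 else if k == M then
    (if (S < M.*2)%N then s else if S == M.*2 then 2 * s / (1 + s) else 1)
  else 0.

(** This is A_S; exchanging n and m gives B_S. Likewise [kept_sum] gives A_S(M) and B_S(M). *)
Definition win_sum {R : realFieldType} (n m S : nat) : R :=
  \sum_(k < S.+1) win_weight n m S k.

Definition kept_sum {R : realFieldType} (s : R) (M n m S : nat) : R :=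
  \sum_(k < S.+1) win_weight n m S k * threshold s M S k.

Section conditional.
Context {R : realFieldType}.
Implicit Types (n m S k l M : nat) (s : R).

Lemma win_ge0 k l : 0 <= win k l :> R.
Proof. by rewrite /win; case: ifP => // _; case: ifP => // _; rewrite invr_ge0. Qed.

Lemma win_le1 k l : win k l <= 1 :> R.
Proof.
by rewrite /win; case: ifP => // _; case: ifP => // _; rewrite invf_le1 ?ler1n.
Qed.

Lemma win_gt k l : (l < k)%N -> win k l = 1 :> R.
Proof. by rewrite /win => ->. Qed.

Lemma win_weight_ge0 n m S k : 0 <= win_weight n m S k :> R.
Proof.
by rewrite /win_weight; case: ifP => // _; rewrite !mulr_ge0 ?ler0n ?win_ge0.
Qed.

Lemma win_sum_ge0 n m S : 0 <= win_sum n m S :> R.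
Proof. by apply: sumr_ge0 => k _; apply: win_weight_ge0. Qed.

Lemma win_sum_gt0 n m S : (m < n)%N -> (S <= n + m)%N ->
  0 < win_sum n m S :> R.
Proof.
(* At k = min(S, n) the other count is at most k, with equality only for S = 0, so this term is
   positive. *)
move=> mn Snm; have kS : (minn S n < S.+1)%N by rewrite ltnS geq_minl.
rewrite /win_sum (bigD1 (Ordinal kS)) //=; apply: ltr_wpDr.
  by apply: sumr_ge0 => k _; apply: win_weight_ge0.
rewrite /win_weight -ltnS kS !mulr_gt0 ?ltr0n ?bin_gt0 ?geq_minr //.
  by lia.
rewrite /win; case: ifP => // lt; case: ifP => [|neq]; first by rewrite invr_gt0.
by move: lt neq; lia.
Qed.

Lemma threshold_itv S k s M : (0 < s <= 1) ->
  0 <= threshold s M S k <= 1.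
Proof.
move=> /andP[s0 s1]; rewrite /threshold; do ![case: ifP => _]; rewrite ?lexx ?ler01 //.
  by rewrite ltW.
apply/andP; split; first by rewrite !mulr_ge0 ?invr_ge0 ?addr_ge0 // ltW.
by rewrite ler_pdivrMr; lra.
Qed.

Lemma threshold_mono s M S k l : (0 < s <= 1) -> (l <= k)%N ->
  threshold s M S l <= threshold s M S k.
Proof.
move=> s01; rewrite leq_eqVlt => /predU1P[->//|lk].
have /andP[k0 _] := threshold_itv S k M s01.
have /andP[_ l1] := threshold_itv S l M s01.
have [Mk|kM] := ltnP M k; first by rewrite {2}/threshold Mk.
have lM := leq_trans lk kM.
by rewrite {1}/threshold ltnNge (ltnW lM) /= ltn_eqF.
Qed.

(** At k = M the value climbs through s <= 2 s / (1 + s) <= 1 as S passes [M.*2]; both bounds use s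
    <= 1. *)
Lemma threshold_step s M S k : (0 < s <= 1) ->
  threshold s M S k <= threshold s M S.+1 k.
Proof.
move=> /andP[s0 s1]; rewrite /threshold; case: ifP => // _; case: ifP => // _.
have H : s <= 2 * s / (1 + s) by rewrite ler_pdivlMr; nra.
have H1 : 2 * s / (1 + s) <= 1 by rewrite ler_pdivrMr; lra.
by do ![case: ifP => ? //]; lia.
Qed.

Lemma natr_bin_succ n k :
  k.+1%:R * 'C(n, k.+1)%:R = (n%:R - k%:R) * 'C(n, k)%:R :> R.
Proof.
rewrite -natrM mul_bin_left natrM; have [nk|kn] := ltnP n k.
  by rewrite bin_small // !mulr0.
by rewrite natrB.
Qed.

(* One more draw changes the leader only at a tie: in the sum for S.+1 the
   weight k/2 + l/2 of a tie k = l is redistributed as 0 + l, so that shifting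
   an index turns the indicator [l < k] into [l <= k] and conversely. *)
Lemma win_sum_succ n m S :
  S.+1%:R * win_sum n m S.+1 = (n%:R + m%:R - S%:R) * win_sum n m S +
    2^-1 * (n%:R - m%:R) *
      \sum_(k < S.+1) 'C(n, k)%:R * 'C(m, k)%:R * (k == S - k :> nat)%N%:R :> R.
Proof.
transitivity (\sum_(k < S.+2) (k%:R * 'C(n, k)%:R) * 'C(m, S.+1 - k)%:R
      * (S.+1 - k < k)%N%:R +
    \sum_(k < S.+2) 'C(n, k)%:R * ((S.+1 - k)%:R * 'C(m, S.+1 - k)%:R)
      * (S.+1 - k <= k)%N%:R : R).
  rewrite -big_split /= /win_sum big_distrr /=; apply: eq_bigr => -[k kS] _ /=.
  rewrite /win_weight -ltnS kS /win.
  have -> : S.+1%:R = k%:R + (S.+1 - k)%:R :> R by rewrite -natrD subnKC.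
  by case: (ltngtP (S.+1 - k)%N k) => [_|_|e] /=; [ring|ring|rewrite e; field].
(* The first sum loses its zero term k = 0 and the second its zero term k = S + 1; shifting the
   first lets both run over k <= S. *)
rewrite big_ord_recl !mul0r add0r [X in _ + X]big_ord_recr /= subnn.
rewrite mul0r mulr0 mul0r addr0.
rewrite -big_split /= /win_sum !big_distrr -big_split /=.
apply: eq_bigr => -[k /= kS] _; rewrite /bump /= add1n; rewrite ltnS in kS.
rewrite subSS subSn // !natr_bin_succ !ltnS /win_weight kS /win.
have -> : S%:R = k%:R + (S - k)%:R :> R by rewrite -natrD subnKC.
by case: (ltngtP (S - k)%N k) => [lk|lk|e] /=; rewrite ?ltnS; [ring|ring|rewrite e; field].
Qed.

(** The tie weight t is symmetric in n and m and enters the recurrences for A and B with opposite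
    signs, so (S + 1) times the difference is (n - m) t (A_S + B_S) / 2. *)
Lemma win_sum_step n m S : (m <= n)%N ->
  win_sum n m S * win_sum m n S.+1 <= win_sum n m S.+1 * win_sum m n S :> R.
Proof.
move=> mn; rewrite -(@ler_pM2l _ S.+1%:R) ?ltr0n // mulrCA win_sum_succ.
rewrite [leRHS]mulrA win_sum_succ.
rewrite (eq_bigr (fun k : 'I_S.+1 =>
  'C(n, k)%:R * 'C(m, k)%:R * (k == S - k :> nat)%N%:R : R)); last first.
  by move=> k _; rewrite [X in X * _]mulrC.
set t := \sum_(k < S.+1) _; have t0 : 0 <= t.
  by apply: sumr_ge0 => k _; rewrite !mulr_ge0.
have := win_sum_ge0 n m S; have := win_sum_ge0 m n S.
have : 0 <= n%:R - m%:R :> R by rewrite subr_ge0 ler_nat.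
set A := win_sum n m S; set B := win_sum m n S; set D := n%:R - m%:R => D0 B0 A0.
have -> : m%:R - n%:R = - D :> R by rewrite opprB.
rewrite -subr_ge0; set X := (X in 0 <= X).
have -> : X = 2^-1 * D * t * (A + B) by rewrite /X; ring.
by rewrite mulr_ge0 ?(addr_ge0 A0 B0) ?(mulr_ge0 _ t0) ?(mulr_ge0 _ D0) ?invr_ge0.
Qed.

(** Chains single steps by cancelling A_T > 0. Products replace ratios since B_S may vanish. *)
Lemma win_sum_mono n m S T : (m < n)%N -> (S <= T <= n + m)%N ->
  win_sum n m S * win_sum m n T <= win_sum n m T * win_sum m n S :> R.
Proof.
move=> mn /andP[]; elim: T => [|T IH]; first by rewrite leqn0 => /eqP->.
rewrite leq_eqVlt => /predU1P[->//|ST] TN.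
have {}IH := IH ST (ltnW TN); have step := win_sum_step T (ltnW mn).
have T0 := win_sum_gt0 mn (ltnW TN).
rewrite -(ler_pM2l T0) [leLHS]mulrCA.
apply: le_trans (ler_wpM2l (win_sum_ge0 n m S) step) _.
rewrite mulrCA [leRHS]mulrCA; apply: ler_wpM2l => //; exact: win_sum_ge0.
Qed.

Lemma kept_sum_ge0 n m S s M :
  0 < s <= 1 -> 0 <= kept_sum s M n m S.
Proof.
move=> s01; apply: sumr_ge0 => k _; rewrite mulr_ge0 ?win_weight_ge0 //.
by have /andP[] := threshold_itv S k M s01.
Qed.

(** The term k = M, with other count 0, survives the threshold. *)
Lemma kept_sum_gt0 n m s M :
  0 < s <= 1 -> (M <= n)%N -> 0 < kept_sum s M n m M.
Proof.
move=> s01 Mn; rewrite /kept_sum big_ord_recr /=; apply: ltr_wpDl.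
  apply: sumr_ge0 => k _; rewrite mulr_ge0 ?win_weight_ge0 //.
  by have /andP[] := threshold_itv M k M s01.
have /andP[s0 s1] := s01.
rewrite /win_weight leqnn subnn /threshold ltnn eqxx !mulr_gt0 ?ltr0n ?bin_gt0 //.
  by rewrite /win; do ![case: ifP => ?]; rewrite ?invr_gt0 //; lia.
by do ![case: ifP => _] => //; rewrite !mulr_gt0 ?invr_gt0 ?addr_gt0.
Qed.

(** Chebyshev in k: the [win] factors agree on both sides, and the binomial factors are compared by
    [bin_ratio_mono] at l <= k and at S - k <= S - l. *)
Lemma kept_sum_le n m S s M : (m <= n)%N -> (0 < s <= 1) ->
  win_sum n m S * kept_sum s M m n S <= kept_sum s M n m S * win_sum m n S.
Proof.
move=> mn s01; apply: chebyshev_sum => k l; last first.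
  by move=> /andP[lk _]; apply: threshold_mono.
rewrite ltnS => /andP[lk kS]; rewrite /win_weight kS (leq_trans lk kS).
rewrite mulrACA [leRHS]mulrACA [X in _ <= _ * X]mulrC.
apply: ler_wpM2r; first by rewrite mulr_ge0 ?win_ge0.
rewrite -!natrM ler_nat.
have H1 := bin_ratio_mono mn lk.
have H2 : ('C(n, S - k) * 'C(m, S - l) <= 'C(n, S - l) * 'C(m, S - k))%N.
  by apply: bin_ratio_mono => //; lia.
have := leq_mul H1 H2; lia.
Qed.

(** Chebyshev in k compares the weights for S + 1 and S under the threshold fraction of S;
    [threshold_step] then raises that fraction to the one of S + 1. *)
Lemma kept_sum_step n m S s M : (0 < s <= 1) ->
  win_sum n m S.+1 * kept_sum s M n m S <= kept_sum s M n m S.+1 * win_sum n m S.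
Proof.
move=> s01.
have ext (t : nat -> R) : \sum_(k < S.+1) win_weight n m S k * t k =
    \sum_(k < S.+2) win_weight n m S k * t k.
  by rewrite [RHS]big_ord_recr /= /win_weight ltnn mul0r addr0.
have ext1 : win_sum n m S = \sum_(k < S.+2) win_weight n m S k :> R.
  by rewrite [RHS]big_ord_recr /= {2}/win_weight ltnn addr0.
rewrite /kept_sum ext ext1.
apply: le_trans (chebyshev_sum _ _) _.
- move=> k l /andP[lk _]; rewrite {2}/win_weight; case: ifP => [kS|_]; last first.
    by rewrite mulr0 mulr_ge0 ?win_weight_ge0.
  have lS := leq_trans lk kS.
  rewrite /win_weight lS (leqW kS) (leqW lS).
  rewrite mulrACA [leRHS]mulrACA; apply: ler_pM.
  + by rewrite !mulr_ge0.
  + by rewrite mulr_ge0 ?win_ge0.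
  + rewrite -!natrM ler_nat !subSn //.
    have : (S - k <= S - l)%N by lia.
    move=> /(bin_log_concave m) /(leq_mul (leqnn ('C(n, k) * 'C(n, l)))); lia.
  (* For l < k, either l < S + 1 - l and the left side is 0, or all [win] factors but the one of l
     at S + 1 equal 1. *)
  + move: lk; rewrite leq_eqVlt => /predU1P[->//|lk].
    have [lS'|Sl] := ltnP l (S.+1 - l).
      rewrite {1}/win ltnNge (ltnW lS') /= ltn_eqF // mul0r.
      by rewrite mulr_ge0 ?win_ge0.
    rewrite [win k _]win_gt 1?[win k _]win_gt 1?[win l (S - l)]win_gt; try lia.
    by rewrite !mulr1 win_le1.
- by move=> k l /andP[lk _]; apply: threshold_mono.
- apply: ler_wpM2r; first by rewrite -ext1 win_sum_ge0.
  apply: ler_sum => k _; apply: ler_wpM2l; first exact: win_weight_ge0.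
  exact: threshold_step.
Qed.

Lemma kept_sum_mono n m S T s M : (m < n)%N -> (0 < s <= 1) ->
  (S <= T <= n + m)%N ->
  kept_sum s M n m S / win_sum n m S <= kept_sum s M n m T / win_sum n m T.
Proof.
move=> mn s01 /andP[]; elim: T => [|T IH]; first by rewrite leqn0 => /eqP->.
rewrite leq_eqVlt => /predU1P[->//|ST] TN.
apply: le_trans (IH ST (ltnW TN)) _.
rewrite ler_pdivrMr ?win_sum_gt0 ?(ltnW TN) // mulrAC.
by rewrite ler_pdivlMr ?win_sum_gt0 // mulrC kept_sum_step.
Qed.

(** With g(S) = A_S(M) / A_S, bound B_S(M) by B_S g(S), then apply Chebyshev in S. *)
Lemma kept_total_le n m s M (W : nat -> R) : (m < n)%N -> (0 < s <= 1) ->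
  (forall S, 0 <= W S) ->
  (\sum_(S < (n + m).+1) W S * win_sum n m S) *
  (\sum_(S < (n + m).+1) W S * kept_sum s M m n S) <=
  (\sum_(S < (n + m).+1) W S * kept_sum s M n m S) *
  (\sum_(S < (n + m).+1) W S * win_sum m n S).
Proof.
move=> mn s01 W0.
pose g S := kept_sum s M n m S / win_sum n m S.
have -> : \sum_(S < (n + m).+1) W S * kept_sum s M n m S =
    \sum_(S < (n + m).+1) W S * win_sum n m S * g S.
  apply: eq_bigr => S _; rewrite -mulrA; congr (_ * _).
  by rewrite /g mulrC divfK // gt_eqF // win_sum_gt0 // -ltnS.
apply: (@le_trans _ _ ((\sum_(S < (n + m).+1) W S * win_sum n m S) *
    (\sum_(S < (n + m).+1) W S * win_sum m n S * g S))).
  apply: ler_wpM2l.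
    by apply: sumr_ge0 => S _; rewrite mulr_ge0 ?win_sum_ge0.
  apply: ler_sum => -[S /= SN] _; rewrite -mulrA; apply: ler_wpM2l => //.
  rewrite /g mulrA ler_pdivlMr ?win_sum_gt0 //.
  by rewrite mulrC [leRHS]mulrC kept_sum_le // ltnW.
apply: (@chebyshev_sum _ _ (fun S => W S * win_sum n m S)
    (fun S => W S * win_sum m n S)) => [T S|T S] /andP[ST TN].
  rewrite mulrACA [leRHS]mulrACA [W T * W S]mulrC.
  by apply: ler_wpM2l; rewrite ?mulr_ge0 ?win_sum_mono // ST.
by apply: kept_sum_mono => //; rewrite ST.
Qed.

End conditional.

(** * Regrouping the product law by the sum *)

(** As G vanishes off the rectangle, its sum extends to the triangle k + l <= n + m, which is cut
    along antidiagonals. *)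
Lemma sum_antidiagonal (R : realFieldType) (n m : nat) (G : nat -> nat -> R) :
  (forall k l, (n < k)%N || (m < l)%N -> G k l = 0) ->
  \sum_(k < n.+1) \sum_(l < m.+1) G k l =
  \sum_(S < (n + m).+1) \sum_(k < S.+1) G k (S - k)%N.
Proof.
move=> G0; pose N := (n + m).+1.
transitivity (\sum_(0 <= k < N) \sum_(k <= S < N) G k (S - k)%N).
  rewrite [RHS](big_cat_nat (n := n.+1)) /= ?ltnS ?leq_addr //.
  rewrite [X in _ + X]big_nat [X in _ + X]big1 ?addr0; last first.
    move=> k /andP[nk _]; by rewrite big1 // => S _; rewrite G0 ?nk.
  rewrite big_mkord; apply: eq_bigr => -[k /= kn] _; rewrite ltnS in kn.
  have -> : \sum_(k <= S < N) G k (S - k)%N = \sum_(0 <= l < N - k) G k l.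
    by rewrite -{1}[k]add0n big_addn; apply: eq_bigr => l _; rewrite addnK.
  rewrite [RHS](big_cat_nat (n := m.+1)) /= ?leq0n //; last by rewrite /N; lia.
  rewrite [X in _ = _ + X]big_nat [X in _ = _ + X]big1 ?addr0 ?big_mkord //.
  by move=> l /andP[ml _]; rewrite G0 // ml orbT.
under eq_bigr do rewrite (big_nat_widenl _ 0) //=.
rewrite (exchange_big_dep predT) //= big_mkord; apply: eq_bigr => -[S /= SN] _.
by rewrite -(big_mkord predT (fun k => G k (S - k)%N)) [RHS](big_nat_widen _ _ N).
Qed.

Lemma sum_binomial_pmf (R : realType) (n m : nat) (p : R)
    (F : nat -> nat -> R) :
  \sum_(k < n.+1) \sum_(l < m.+1) binomial_pmf n p k * binomial_pmf m p l * F k l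
  = \sum_(S < (n + m).+1) p ^+ S * (1 - p) ^+ (n + m - S) *
      \sum_(k < S.+1) 'C(n, k)%:R * 'C(m, S - k)%:R * F k (S - k)%N.
Proof.
rewrite (@sum_antidiagonal _ n m
  (fun k l => binomial_pmf n p k * binomial_pmf m p l * F k l)); last first.
  by move=> k l /orP[] /bin_small; rewrite /binomial_pmf => ->; rewrite mulr0n ?mulr0 !mul0r.
apply: eq_bigr => -[S /= SN] _; rewrite big_distrr /=.
apply: eq_bigr => -[k /= kS] _; rewrite ltnS in kS; rewrite /binomial_pmf.
(* Off the support both sides vanish; on it the truncated subtractions in the exponents are
   exact. *)
have [nk|kn] := ltnP n k; first by rewrite bin_small // mulr0n !mul0r mulr0.
have [ml|lm] := ltnP m (S - k).
  by rewrite (bin_small ml) mulr0n !(mul0r, mulr0).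
rewrite -[_ *+ 'C(n, k)]mulr_natl -[_ *+ 'C(m, S - k)]mulr_natl.
have -> : (n + m - S = (n - k) + (m - (S - k)))%N by lia.
have -> : p ^+ S = p ^+ k * p ^+ (S - k) by rewrite -exprD subnKC.
by rewrite exprD /unstable.onem; ring.
Qed.

(** * Joint law of two independent binomial variables *)

Section joint.
Local Open Scope ereal_scope.
Context {R : realType} {d : measure_display} {T : measurableType d}.
Context {P : probability T R} {p : R} (hp : (0 <= p <= 1)%R).

Lemma binomial_prob_pmf n (U : set nat) :
  binomial_prob n p U = \sum_(k < n.+1) (binomial_pmf n p k)%:E * \d_(k : nat) U.
Proof. by move: hp => /andP[p0 p1]; exact: (@binomial_probE R n p p0 p1 U). Qed.

Lemma independent_RV2_sym d1 d2 (T1 : measurableType d1) (T2 : measurableType d2)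
    (X : T -> T1) (Y : T -> T2) :
  independent_RV2 P X Y -> independent_RV2 P Y X.
Proof. by move=> XY A B mA mB; rewrite setIC muleC XY. Qed.

(** Slice by the value k of X: independence applies to each of the disjoint slices k <= n, and the
    rest lies in the null event X > n. *)
Lemma prob_joint n m (X Y : {RV P >-> nat}) (Q : nat -> nat -> bool) :
  distribution P X = binomial_prob n p ->
  distribution P Y = binomial_prob m p ->
  independent_RV2 P X Y ->
  P [set t | Q (X t) (Y t)] = (\sum_(k < n.+1) \sum_(l < m.+1)
    binomial_pmf n p k * binomial_pmf m p l * (Q k l)%:R)%:E.
Proof.
move=> hX hY XY.
have hXE A : P (X @^-1` A) = binomial_prob n p A by rewrite -hX.
have hYE A : P (Y @^-1` A) = binomial_prob m p A by rewrite -hY.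
pose F k := X @^-1` [set k] `&` Y @^-1` [set l | Q k l].
have mF k : measurable (F k) by apply: measurableI; apply: measurable_funPTI.
have mXn : measurable (X @^-1` [set k | (n < k)%N]) by apply: measurable_funPTI.
have EF : [set t | Q (X t) (Y t)] = \bigcup_k F k.
  apply/seteqP; split => [t Qt|t [k _ [<- //]]]; by exists (X t).
have mE : measurable [set t | Q (X t) (Y t)] by rewrite EF; apply: bigcup_measurable.
have Xn0 : P (X @^-1` [set k | (n < k)%N]) = 0.
  rewrite hXE binomial_prob_pmf big1 // => -[k /= kn] _.
  by rewrite diracE memNset ?mule0 //= => /(leq_trans kn); rewrite ltnn.
have -> : [set t | Q (X t) (Y t)] = (\big[setU/set0]_(k < n.+1) F k) `|`
    ([set t | Q (X t) (Y t)] `&` X @^-1` [set k | (n < k)%N]).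
  apply/seteqP; split => t.
    move=> Qt; have [Xn|nX] := ltnP n (X t); first by right.
    by left; rewrite -bigcup_mkord; exists (X t).
  by case=> [|[]//]; rewrite -bigcup_mkord => -[k _ [/= <-]].
rewrite measureU0; last 3 first.
- exact: bigsetU_measurable.
- exact: measurableI.
- by apply: (subset_measure0 (measurableI _ _ mE mXn) mXn) => // t [].
rewrite measure_bigsetU_ord //; last first.
  apply/trivIsetP => i j _ _ /eqP ij; apply/seteqP; split => // t.
  move=> [[/= Xi _] [/= Xj _]]; apply: ij.
  by apply: val_inj; rewrite /= -Xi -Xj.
rewrite -sumEFin; apply: eq_bigr => -[k /= kn] _.
rewrite XY // hXE hYE binomial_prob_pmf (bigD1 (Ordinal kn)) //=.
rewrite big1 ?adde0; last first.
  move=> i ik; rewrite diracE memNset ?mule0 //= => e.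
  by move: ik; rewrite -val_eqE /= e eqxx.
rewrite diracE mem_set // mule1 binomial_prob_pmf ge0_sume_distrr; last first.
  by move=> l _; rewrite mule_ge0 // lee_fin binomial_pmf_ge0.
rewrite -sumEFin; apply: eq_bigr => l _.
rewrite diracE !EFinM muleA; congr (_ * _).
by have -> : ((l : nat) \in [set l0 | Q k l0]) = Q k l by apply/idP/idP; rewrite inE.
Qed.

End joint.

(** * Winning probabilities as expectations *)

(** The payoff at X = k, Y = l, whose expectation is p_X(M, rho). *)
Definition win_kernel {R : realFieldType} (rho : R) (M : int) (k l : nat) : R :=
  ((M < k%:Z) && (l < k)%N)%:R
  + 2^-1 * ((k == l) && (M < l%:Z))%:R
  + (rho + 1)^-1 * ((k%:Z == M) && (l%:Z < M))%:R
  + (rho + 2)^-1 * ((k == l) && (l%:Z == M))%:R.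

Lemma win_kernelN1 (R : realFieldType) (rho : R) (k l : nat) :
  win_kernel rho (-1) k l = win k l.
Proof.
rewrite /win_kernel /win; have -> : (k%:Z == -1) = false by lia.
have -> : (l%:Z == -1) = false by lia.
have -> : -1 < k%:Z by lia.
have -> : -1 < l%:Z by lia.
by case: ltngtP => _ /=; ring.
Qed.

(** At k = M, comparing k + l with [M.*2] amounts to comparing l with M. *)
Lemma win_kernel_nat (R : realFieldType) (rho : R) (M k l : nat) : 0 <= rho ->
  win_kernel rho M k l = win k l * threshold (rho + 1)^-1 M (k + l) k.
Proof.
move=> rho0; rewrite /win_kernel /win /threshold !ltz_nat !eqz_nat.
have [lk|kl|<-] := ltngtP l k => /=.
- have [Mk|kM|->] := ltngtP M k => /=; [ring|ring|].
  by rewrite lk -addnn ltn_add2l lk /=; ring.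
- have -> : (k == M) && (l < M)%N = false by lia.
  by rewrite andbF /=; ring.
- have [Ml|lM|->] := ltngtP M l => /=; [ring|ring|].
  rewrite -addnn ltnn eqxx /=; field.
  by rewrite !gt_eqF //; lra.
Qed.

Section sums.
Context {R : realType} (n m : nat) (p rho : R).

Definition sum_weight (S : nat) : R := p ^+ S * (1 - p) ^+ (n + m - S).

Lemma win_kernel_sumN1 :
  \sum_(k < n.+1) \sum_(l < m.+1)
    binomial_pmf n p k * binomial_pmf m p l * win_kernel rho (-1) k l =
  \sum_(S < (n + m).+1) sum_weight S * win_sum n m S.
Proof.
rewrite sum_binomial_pmf; apply: eq_bigr => S _; congr (_ * _).
apply: eq_bigr => -[k /= kS] _; rewrite ltnS in kS.
by rewrite win_kernelN1 /win_weight kS.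
Qed.

Lemma win_kernel_sum_nat M : 0 <= rho ->
  \sum_(k < n.+1) \sum_(l < m.+1)
    binomial_pmf n p k * binomial_pmf m p l * win_kernel rho (Posz M) k l =
  \sum_(S < (n + m).+1) sum_weight S * kept_sum (rho + 1)^-1 M n m S.
Proof.
move=> rho0; rewrite sum_binomial_pmf; apply: eq_bigr => S _; congr (_ * _).
apply: eq_bigr => -[k /= kS] _; rewrite ltnS in kS.
by rewrite win_kernel_nat // /win_weight kS subnKC // mulrA.
Qed.

End sums.

Section win_prob.
Local Open Scope ereal_scope.
Context {R : realType} {d : measure_display} {T : measurableType d}.
Context {P : probability T R}.

Lemma win_probE (n m : nat) (rho p : R) (X Y : {RV P >-> nat}) (M : int) :
  (0 <= p <= 1)%R ->
  distribution P X = binomial_prob n p ->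
  distribution P Y = binomial_prob m p ->
  independent_RV2 P X Y ->
  win_prob P X Y rho M = (\sum_(k < n.+1) \sum_(l < m.+1)
    binomial_pmf n p k * binomial_pmf m p l * win_kernel rho M k l)%:E.
Proof.
move=> p01 hX hY XY; rewrite /win_prob.
have E1 : [set t | (M < (X t)%:Z)%R /\ (Y t < X t)%N] =
    [set t | (M < (X t)%:Z)%R && (Y t < X t)%N].
  by apply/seteqP; split => t /= /andP.
have E2 : [set t | X t = Y t /\ (M < (Y t)%:Z)%R] =
    [set t | (X t == Y t) && (M < (Y t)%:Z)%R].
  by apply/seteqP; split => t /= => [[/eqP -> ->]//|/andP[/eqP]].
have E3 : [set t | (X t)%:Z = M /\ ((Y t)%:Z < M)%R] =
    [set t | ((X t)%:Z == M) && ((Y t)%:Z < M)%R].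
  by apply/seteqP; split => t /= => [[/eqP -> ->]//|/andP[/eqP]].
have E4 : [set t | X t = Y t /\ (Y t)%:Z = M] =
    [set t | (X t == Y t) && ((Y t)%:Z == M)].
  by apply/seteqP; split => t /= => [[/eqP -> /eqP ->]//|/andP[/eqP ? /eqP]].
rewrite E1 E2 E3 E4.
rewrite (prob_joint p01 (fun k l => (M < k%:Z)%R && (l < k)%N) hX hY XY).
rewrite (prob_joint p01 (fun k l => (k == l) && (M < l%:Z)%R) hX hY XY).
rewrite (prob_joint p01 (fun k l => (k%:Z == M) && (l%:Z < M)%R) hX hY XY).
rewrite (prob_joint p01 (fun k l => (k == l) && (l%:Z == M)) hX hY XY).
rewrite -!EFinM -!EFinD; congr _%:E.
rewrite !big_distrr -!big_split; apply: eq_bigr => k _ /=.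
rewrite !big_distrr -!big_split; apply: eq_bigr => l _ /=.
by rewrite /win_kernel; ring.
Qed.

Lemma win_probN1 (rho : R) (X Y : T -> nat) :
  win_prob P X Y rho (-1)%R =
  P [set t | (Y t < X t)%N] + (2^-1)%:E * P [set t | X t = Y t].
Proof.
rewrite /win_prob.
have -> : [set t | (-1 < (X t)%:Z)%R /\ (Y t < X t)%N] = [set t | (Y t < X t)%N].
  by apply/seteqP; split => t /=; [case|split => //; lia].
have -> : [set t | X t = Y t /\ (-1 < (Y t)%:Z)%R] = [set t | X t = Y t].
  by apply/seteqP; split => t /=; [case|split => //; lia].
have -> : [set t | (X t)%:Z = (-1)%R /\ ((Y t)%:Z < -1)%R] = set0.
  by apply/seteqP; split => t //= [].
have -> : [set t | X t = Y t /\ (Y t)%:Z = (-1)%R] = set0.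
  by apply/seteqP; split => t //= [].
by rewrite measure0 !mule0 !adde0.
Qed.

End win_prob.

(** * Comparison of the quotients *)

(** The case b = 0, where the right side is +oo, occurs for p_Y(M, rho) when M > n'. *)
Lemma ler_ediv (R : realType) (a b c e : R) :
  0 < a -> 0 <= b -> 0 < e -> c * b <= a * e ->
  (c%:E / e%:E <= a%:E / b%:E)%E.
Proof.
move=> a0 b0 e0 cb; rewrite !inver (gt_eqF e0) -EFinM.
have [b00|bN0] := eqVneq b 0; first by rewrite gt0_muley ?lte_fin // leey.
have {}b0 : 0 < b by rewrite lt_def bN0.
by rewrite -EFinM lee_fin ler_pdivrMr // mulrAC ler_pdivlMr.
Qed.

Local Open Scope ereal_scope.

Theorem lemma2p6 (R : realType) (d : measure_display) (T : measurableType d)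
    (P : probability T R) (n n' : nat) (rho p : R) (X Y : {RV P >-> nat})
    (hn : (n' < n)%N) (hrho : (0 <= rho)%R) (hp : (0 < p < 1)%R)
    (hX : distribution P X = binomial_prob n p)
    (hY : distribution P Y = binomial_prob n' p)
    (hXY : independent_RV2 P X Y) :
  (forall M : int, (0 <= M <= n%:Z)%R ->
     win_ratio P X Y rho M >= win_ratio P X Y rho (-1)%R) /\
  win_ratio P X Y rho (-1)%R =
    (P [set t | (Y t < X t)%N] + (2^-1)%:E * P [set t | X t = Y t]) /
    (P [set t | (X t < Y t)%N] + (2^-1)%:E * P [set t | Y t = X t]).
Proof.
split; last by rewrite /win_ratio !win_probN1.
case=> // M; rewrite lez_nat => Mn.
have /andP[p0 p1] := hp.
have p01 : (0 <= p <= 1)%R by rewrite !ltW.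
have q0 : (0 < 1 - p)%R by rewrite subr_gt0.
have hYX := independent_RV2_sym hXY.
have W0 S : (0 < sum_weight n n' p S)%R by rewrite mulr_gt0 ?exprn_gt0.
have s01 : (0 < (rho + 1)^-1 <= 1)%R.
  have r1 : (0 < rho + 1)%R by rewrite ltr_wpDl.
  by rewrite invr_gt0 r1 invf_le1 // lerDr.
have WC S : sum_weight n' n p S = sum_weight n n' p S.
  by rewrite /sum_weight addnC.
rewrite /win_ratio (win_probE _ _ p01 hX hY hXY) (win_probE _ _ p01 hY hX hYX).
rewrite (win_probE _ _ p01 hX hY hXY) (win_probE _ _ p01 hY hX hYX).
rewrite !win_kernel_sumN1 !win_kernel_sum_nat //.
rewrite (addnC n' n); under [X in _ / X%:E <= _]eq_bigr do rewrite WC.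
under [X in _ <= _ / X%:E]eq_bigr do rewrite WC.
apply: ler_ediv.
(* p_X(M, rho) > 0 by the term S = M. *)
- have Mnn : (M < (n + n').+1)%N by rewrite ltnS (leq_trans Mn) // leq_addr.
  rewrite (bigD1 (Ordinal Mnn)) //=; apply: ltr_wpDr.
    by apply: sumr_ge0 => S _; rewrite mulr_ge0 ?kept_sum_ge0 // ltW.
  by rewrite mulr_gt0 ?kept_sum_gt0.
- by apply: sumr_ge0 => S _; rewrite mulr_ge0 ?kept_sum_ge0 // ltW.
(* p_Y(-1, rho) > 0 by the term S = 0, the tie X = Y = 0. *)
- rewrite big_ord_recl /=; apply: ltr_wpDr.
    by apply: sumr_ge0 => S _; rewrite mulr_ge0 ?win_sum_ge0 // ltW.
  rewrite mulr_gt0 // /win_sum big_ord1 /win_weight /win /= !bin0.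
  by rewrite !mulr_gt0 ?invr_gt0.
- by apply: kept_total_le => // S; apply: ltW.
Qed.
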